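(* Let $\mathfrak{F}$ be a 2-recognizable, hereditary, semiregular formation with $\mathfrak{N}\subseteq\mathfrak{F}$, and let $G$ be a finite group. Then $\Gamma_\mathfrak{F}(G)$ is planar if and only if either $G\in\mathfrak{F}$ or $G\cong S_3$.
   Context: $\mathfrak{N}$: finite nilpotent groups. A formation is a class of finite groups closed under homomorphic images and subdirect products; hereditary means closed under subgroups; 2-recognizable means a finite group lies in $\mathfrak{F}$ whenever all its 2-generated subgroups do. $\mathcal{I}_\mathfrak{F}(G)$ is the set of $x\in G$ with $\langle x,g\rangle\in\mathfrak{F}$ for all $g\in G$; $\mathfrak{F}$ is semiregular if $\mathcal{I}_\mathfrak{F}(G)$ is a subgroup of $G$ for every finite group $G$. $\Gamma_\mathfrak{F}(G)$ is the graph with vertex set $G\setminus\mathcal{I}_\mathfrak{F}(G)$ where $g,h$ are adjacent iff $\langle g,h\rangle\notin\mathfrak{F}$. A graph is planar if it can be drawn in the plane with edges meeting only at their endpoints (the empty graph counts as planar). *)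

(* Defs.v *)
From HB Require Import structures.
From mathcomp Require Import all_boot all_order all_algebra.
From mathcomp Require Import all_classical all_reals all_analysis.
From mathcomp Require Import Rstruct Rstruct_topology.
From mathcomp Require Import all_fingroup all_solvable.

Set Implicit Arguments.
Unset Strict Implicit.
Unset Printing Implicit Defensive.

Import Order.TTheory GRing.Theory Num.Theory.

Definition group_class := forall gT : finGroupType, {group gT} -> Prop.

Local Open Scope group_scope.

Definition Q_closed (F : group_class) : Prop :=
  forall (gT rT : finGroupType) (G : {group gT}) (f : {morphism G >-> rT}),
    F gT G -> F rT (f @* G)%G.

Definition R0_closed (F : group_class) : Prop :=
  forall (gT : finGroupType) (G N1 N2 : {group gT}),
    normal N1 G -> normal N2 G ->
    F _ (G / N1)%G -> F _ (G / N2)%G -> F _ (G / (N1 :&: N2))%G.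

Definition formation (F : group_class) : Prop := Q_closed F /\ R0_closed F.

Definition hereditary (F : group_class) : Prop :=
  forall (gT : finGroupType) (G H : {group gT}), H \subset G -> F gT G -> F gT H.

Definition two_recognizable (F : group_class) : Prop :=
  forall (gT : finGroupType) (G : {group gT}),
    (forall x y, x \in G -> y \in G -> F gT <<[set x; y]>>%G) -> F gT G.

Definition IF (F : group_class) (gT : finGroupType) (G : {group gT}) : {set gT} :=
  [set x in G | `[< forall g, g \in G -> F gT <<[set x; g]>>%G >]].

Definition F_semiregular (F : group_class) : Prop :=
  forall (gT : finGroupType) (G : {group gT}), group_set (IF F G).

Definition contains_nilpotent (F : group_class) : Prop :=
  forall (gT : finGroupType) (G : {group gT}), nilpotent G -> F gT G.

Definition GammaV (F : group_class) (gT : finGroupType) (G : {group gT}) : {set gT} :=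
  G :\: IF F G.

Definition GammaAdj (F : group_class) (gT : finGroupType) (g h : gT) : Prop :=
  ~ F gT <<[set g; h]>>%G.

(* ---------- Planarity (topological definition) ----------
   A graph with vertex set V and (symmetric) adjacency adj is planar if it can
   be drawn in the plane R^2: vertices go to distinct points, each edge {u,v}
   is a Jordan arc (continuous injective image of [0,1]) joining the images of
   u and v, arcs avoid the other vertex points, and two arcs of distinct edges
   only meet at common endpoints. For convenience arcs are given for both
   orientations (u,v) and (v,u); arcs of the same unordered edge are not
   compared. *)
Local Open Scope ring_scope.
Local Open Scope classical_set_scope.

Definition unit_interval : set Rdefinitions.R := [set s : Rdefinitions.R | 0 <= s <= 1].

Definition planar (T : finType) (V : {set T}) (adj : T -> T -> Prop) : Prop :=
  exists (p : T -> Rdefinitions.R * Rdefinitions.R) (c : T -> T -> Rdefinitions.R -> Rdefinitions.R * Rdefinitions.R),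
    {in V &, injective p} /\
    (forall u v, u \in V -> v \in V -> u != v -> adj u v ->
       [/\ {within unit_interval, continuous (c u v)},
           {in unit_interval &, injective (c u v)},
           c u v 0 = p u, c u v 1 = p v &
           forall w s, w \in V -> 0 < s < 1 -> c u v s <> p w]) /\
    (forall u v u' v', u \in V -> v \in V -> u' \in V -> v' \in V ->
       u != v -> u' != v' -> adj u v -> adj u' v' ->
       [set u; v]%SET != [set u'; v']%SET ->
       forall s t, s \in unit_interval -> t \in unit_interval ->
         c u v s = c u' v' t -> (s == 0 \/ s == 1) /\ (t == 0 \/ t == 1)).

(* Main.v *)
(**
  Planar implies [G \in F] or [G ~ S_3]: write [x ~ y] when [<x, y>] is not in
  [F]. Any pair whose generated subgroup contains [x] and [y] is again adjacent,
  so one edge produces many others. If [x ~ y] with neither [x] nor [y] an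
  involution, then [x, x^-1, y] against [xy, xy^-1, yx] is a [K_{3,3}], unless
  [<x, y>] is a quotient of the quaternion group, hence nilpotent. So [<x, y>]
  is dihedral with rotation [r]; three generators of [<r>] against three
  reflections form a [K_{3,3}] unless [r] has order 3 or 6, and order 6 is ruled
  out by subdirect products if [S_3 \in F] and by a [K_{3,3}] otherwise. Hence
  every edge generates an [S_3], all vertices have order 2 or 3, and
  semiregularity forces the isolated subgroup to be trivial. An involution
  outside a given [S_3] would yield a [K_{3,3}], an element of order 6 or one of
  order 4, so [G] is that [S_3].

  [K_{3,3}] is not planar by van Kampen's parity argument. For vertex-disjoint
  edges [e], [f] the vectors [e s - f t] do not vanish; counting the crossings
  of the positive real axis along the boundary of the square of parameters
  [(s, t)] gives an identity modulo 2 between the numbers of turns of [e] around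
  the ends of [f] and of [f] around the ends of [e]. Summed over the 18
  disjoint pairs of edges these identities are contradictory. By compactness
  the arcs can be replaced by finite sequences of sample points.
*)
Require Import Defs.
From mathcomp Require Import all_boot all_order all_algebra.
From mathcomp Require Import all_classical all_reals all_analysis.
From mathcomp Require Import Rstruct Rstruct_topology.
From mathcomp Require Import all_fingroup all_solvable.
From mathcomp Require Import fintype finset zify lra.
From Stdlib Require Import Btauto.

Set Implicit Arguments.
Unset Strict Implicit.
Unset Printing Implicit Defensive.

Import Order.TTheory GRing.Theory Num.Theory.
Import numFieldNormedType.Exports.

(** * Parity of turns and the nonplanarity of K_{3,3} *)

Section RayCrossing.
Local Open Scope ring_scope.
Variable R : realType.
Implicit Types (u v w : R * R) (e f : nat -> R * R).

(** The half-plane includes the positive but not the negative real axis. Hence it contains exactly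
    one of [u] and [- u] when [u != 0], and walks may have points on the axis. *)
Definition upper u : bool := (0 < u.2) || ((u.2 == 0) && (0 < u.1)).

(** Testing [u.1] alone suffices for short steps: if such a step changes the half-plane, [v.1] has
    the same sign. *)
Definition raycross u v : bool := (upper u (+) upper v) && (0 < u.1).

Lemma ler_prod_norm (eps : R) u :
  (eps <= `|u|) = (eps <= `|u.1|) || (eps <= `|u.2|).
Proof. by rewrite prod_normE le_max. Qed.

Lemma ltr_prod_norm (eps : R) u :
  (`|u| < eps) = (`|u.1| < eps) && (`|u.2| < eps).
Proof. by rewrite prod_normE gt_max. Qed.

Lemma upperN u : u != 0 -> upper (- u) = ~~ upper u.
Proof.
case: u => x y; rewrite /upper /= xpair_eqE /= !oppr_gt0 oppr_eq0.
by case: (ltrgtP y 0) => //= _; rewrite andbT; case: (ltrgtP x 0).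
Qed.

(** A step shorter than [eps] that changes the half-plane has both ordinates below [eps] in absolute
    value. The sup norms are then attained by the abscissas, which are too large to change sign in
    such a step. *)
Lemma upper_neq_abscissa (eps : R) u v :
  eps <= `|u| -> eps <= `|v| -> `|u - v| < eps -> upper u != upper v ->
  u.1 != 0 /\ (0 < u.1) = (0 < v.1).
Proof.
rewrite !ler_prod_norm ltr_prod_norm /=; case: u v => [x y] [x' y'] /=.
rewrite /upper /= => hu hv /andP[hx hy] huv.
have [hy1 hy2] : `|y| < eps /\ `|y'| < eps.
  move: hy huv; rewrite !ltr_norml.
  case: (ltrgtP y 0) => hy0; case: (ltrgtP y' 0) => hy'0 /=; rewrite ?eqxx // => /andP[? ?] _;
    split; lra.
have {hu} hu : eps <= `|x| by case/orP: hu => // h; lra.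
have {hv} hv : eps <= `|x'| by case/orP: hv => // h; lra.
have e0 : 0 < eps by apply: le_lt_trans hy1; exact: normr_ge0.
move: hx hu hv; rewrite ltr_norml !ler_normr => /andP[h1 h2] h3 h4.
split; first by apply/eqP => h; move: h3; rewrite h oppr0 orbb; lra.
by case: (ltrP 0 x) => h; case: (ltrP 0 x') => h' //; case/orP: h3 => h3; case/orP: h4 => h4; lra.
Qed.

(** Around a triangle with short sides the half-plane changes either never or twice, and both
    changes occur on the same side of the vertical axis. *)
Lemma raycrossD (eps : R) u v w :
  eps <= `|u| -> eps <= `|v| -> eps <= `|w| ->
  `|u - v| < eps -> `|v - w| < eps -> `|u - w| < eps ->
  raycross u v (+) raycross v w = raycross u w.
Proof.
move=> hu hv hw huv hvw huw.
have := upper_neq_abscissa hu hv huv; have := upper_neq_abscissa hv hw hvw.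
have := upper_neq_abscissa hu hw huw; rewrite /raycross.
case: (upper u); case: (upper v); case: (upper w) => //=;
  rewrite ?addbF ?addFb //.
- by move=> /(_ isT)[_ ->] /(_ isT)[_ ->].
- by move=> _ _ /(_ isT)[_ ->]; rewrite addbb.
- by move=> _ _ /(_ isT)[_ ->]; rewrite addbb.
- by move=> /(_ isT)[_ ->] /(_ isT)[_ ->].
Qed.

(* The opposite of a step across the positive ray is a step across the negative one. *)
Lemma raycrossN (eps : R) u v : 0 < eps ->
  eps <= `|u| -> eps <= `|v| -> `|u - v| < eps ->
  raycross (- u) (- v) = raycross u v (+) (upper u (+) upper v).
Proof.
move=> e0 hu hv huv.
have u0 : u != 0 by rewrite -normr_gt0 (lt_le_trans e0).
have v0 : v != 0 by rewrite -normr_gt0 (lt_le_trans e0).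
rewrite /raycross !upperN //.
rewrite addbN addNb negbK (_ : (- u).1 = - u.1) // oppr_gt0; have := upper_neq_abscissa hu hv huv.
case: (upper u); case: (upper v) => //= /(_ isT)[+ _]; by case: (ltrgtP u.1 0).
Qed.

(* Parity of the number of turns of the walk [e] around [v]. *)
Definition turns n e v : bool :=
  \big[addb/false]_(k < n) raycross (e k - v) (e k.+1 - v).

Variables (eps : R) (n : nat) (e f : nat -> R * R).
Hypothesis eps0 : 0 < eps.
Hypothesis ef : forall k l, (k <= n)%N -> (l <= n)%N -> eps <= `|e k - f l|.
Hypothesis estep : forall k, (k < n)%N -> `|e k - e k.+1| < eps / 2.
Hypothesis fstep : forall k, (k < n)%N -> `|f k - f k.+1| < eps / 2.

(** Each cell of the parameter grid is cut into two triangles along the step from [e m - f l] to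
    [e m.+1 - f l.+1], which is shorter than [eps] because [e] and [f] move by less than [eps / 2].
    Crossings along interior sides cancel. *)
Lemma turns_shift l : (l < n)%N ->
  turns n e (f l) (+) turns n e (f l.+1) =
  raycross (e 0%N - f l) (e 0%N - f l.+1) (+) raycross (e n - f l) (e n - f l.+1).
Proof.
move=> ln; rewrite /turns.
suff H m : (m <= n)%N ->
  \big[addb/false]_(k < m) raycross (e k - f l) (e k.+1 - f l) (+)
  \big[addb/false]_(k < m) raycross (e k - f l.+1) (e k.+1 - f l.+1) =
  raycross (e 0%N - f l) (e 0%N - f l.+1) (+) raycross (e m - f l) (e m - f l.+1).
  exact: H.
elim: m => [|m IH] mn; first by rewrite !big_ord0 !addbb.
rewrite !big_ord_recr /=.
have := IH (ltnW mn).
set A := \big[_/_]_(_ < m) _; set B := \big[_/_]_(_ < m) _ => IH'.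
have he := estep mn; have hf := fstep ln.
have he2 : eps / 2 < eps by move: eps0; lra.
have E1 : e m - f l - (e m.+1 - f l) = e m - e m.+1.
  by rewrite opprB addrA subrK.
have E2 j : e j - f l - (e j - f l.+1) = - (f l - f l.+1).
  by rewrite !opprB [LHS]addrC addrA subrK.
have E3 : e m - f l.+1 - (e m.+1 - f l.+1) = e m - e m.+1.
  by rewrite opprB addrA subrK.
have E4 : e m - f l - (e m.+1 - f l.+1) = (e m - e m.+1) - (f l - f l.+1).
  by rewrite !opprB addrACA [RHS]addrACA; congr (_ + _); rewrite addrC.
have T1 := @raycrossD eps (e m - f l) (e m.+1 - f l) (e m.+1 - f l.+1).
have T2 := @raycrossD eps (e m - f l) (e m - f l.+1) (e m.+1 - f l.+1).
have hd : `|e m - e m.+1 - (f l - f l.+1)| < eps.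
  by apply: le_lt_trans (ler_normB _ _) _; lra.
move: T1; rewrite E1 E2 E4 normrN => T1.
move: T2; rewrite E3 E2 E4 normrN => T2.
have {}T1 : _ := T1 (ef (ltnW mn) (ltnW ln)) (ef mn (ltnW ln)) (ef mn ln)
  (lt_trans he he2) (lt_trans hf he2) hd.
have {}T2 : _ := T2 (ef (ltnW mn) (ltnW ln)) (ef (ltnW mn) ln) (ef mn ln)
  (lt_trans hf he2) (lt_trans he he2) hd.
move: IH' T1 T2.
by case: A; case: B; do ?[case: raycross => //=].
Qed.

(** Adding [turns_shift] over [l] makes the crossings along the boundary of the parameter square
    even. Where [e] rests at an end, the vectors are opposite to those counted by [turns n f]; this
    reversal produces the [upper] terms. *)
Lemma turns_exchange :
  turns n e (f 0%N) (+) turns n e (f n) (+) (turns n f (e 0%N) (+) turns n f (e n))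
  = upper (f n - e 0%N) (+) upper (f 0%N - e 0%N)
    (+) (upper (f n - e n) (+) upper (f 0%N - e n)).
Proof.
have he2 : eps / 2 < eps by move: eps0; lra.
have turnsV k : (k <= n)%N ->
    \big[addb/false]_(l < n) raycross (e k - f l) (e k - f l.+1) =
    turns n f (e k) (+) (upper (f n - e k) (+) upper (f 0%N - e k)).
  move=> kn; rewrite /turns.
  (* The corrections from [raycrossN] telescope to the two ends of [f]. *)
  have tel m : upper (f m - e k) (+) upper (f 0%N - e k) =
      \big[addb/false]_(l < m) (upper (f l - e k) (+) upper (f l.+1 - e k)).
    elim: m => [|m IH]; first by rewrite big_ord0 addbb.
    rewrite big_ord_recr /= -IH.
    by case: (upper (f m - _)); case: (upper (f 0%N - _)); case: upper.
  rewrite tel -big_split /=; apply: eq_bigr => l _.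
  rewrite -[e k - f l]opprB -[e k - f l.+1]opprB (raycrossN eps0) //.
  - by rewrite distrC ef // ltnW.
  - by rewrite distrC ef.
  - have -> : f l - e k - (f l.+1 - e k) = f l - f l.+1.
      by rewrite opprB addrA subrK.
    exact: lt_trans (fstep _) _.
have H : turns n e (f 0%N) (+) turns n e (f n) =
    \big[addb/false]_(l < n) raycross (e 0%N - f l) (e 0%N - f l.+1) (+)
    \big[addb/false]_(l < n) raycross (e n - f l) (e n - f l.+1).
  suff H m : (m <= n)%N -> turns n e (f 0%N) (+) turns n e (f m) =
    \big[addb/false]_(l < m) raycross (e 0%N - f l) (e 0%N - f l.+1) (+)
    \big[addb/false]_(l < m) raycross (e n - f l) (e n - f l.+1) by exact: H.
  elim: m => [|m IH] mn; first by rewrite !big_ord0 !addbb.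
  rewrite !big_ord_recr /=; have := IH (ltnW mn); have := turns_shift mn.
  set A := \big[_/_]_(_ < m) _; set B := \big[_/_]_(_ < m) _.
  by case: (turns _ _ (f 0%N)); case: (turns _ _ (f m)); case: (turns _ _ (f m.+1));
    case: A; case: B => //=; do 2![case: raycross => //=].
rewrite H !turnsV //.
by case: (turns _ _ (e 0%N)); case: (turns _ _ (e n)); do 4![case: upper => //=].
Qed.
End RayCrossing.

Lemma K33_walks (R : realType) (eps : R) (n : nat) (p q : 'I_3 -> R * R)
    (c : 'I_3 -> 'I_3 -> nat -> R * R) :
  (0 < eps)%R ->
  (forall i j, c i j 0%N = p i) -> (forall i j, c i j n = q j) ->
  (forall i j k, (k < n)%N -> `|c i j k - c i j k.+1| < eps / 2)%R ->
  (forall i j i' j' k l, i != i' -> j != j' -> (k <= n)%N -> (l <= n)%N ->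
     eps <= `|c i j k - c i' j' l|)%R ->
  False.
Proof.
move=> eps0 c0 cn cstep cc.
pose W i j v := turns n (c i j) v; pose U (u v : R * R) := upper (u - v)%R.
have rel i j i' j' : i != i' -> j != j' ->
    W i j (p i') (+) W i j (q j') (+) (W i' j' (p i) (+) W i' j' (q j))
    (+) (U (q j') (p i) (+) U (p i') (p i)
    (+) (U (q j') (q j) (+) U (p i') (q j))) = false.
  move=> ii jj; apply/eqP; rewrite eqbF_neg negb_add; apply/eqP.
  rewrite /W /U -(c0 i' j') -(cn i' j') -(c0 i j) -(cn i j).
  by apply: (turns_exchange eps0) => *; [exact: cc | exact: cstep | exact: cstep].
have qq j j' : j != j' -> U (q j) (q j') = ~~ U (q j') (q j).
  move=> jj; rewrite /U -upperN ?opprB // -normr_gt0 (lt_le_trans eps0) //.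
  by rewrite -(cn ord0 j') -(cn ord_max j) cc // eq_sym.
pose o1 : 'I_3 := Ordinal (isT : 1 < 3)%N.
(* Each [W i j v] occurs in two of the 18 relations, and the [U] terms leave
   three copies of each [U (q j) (q j') (+) U (q j') (q j) = true]. *)
have := rel ord0 ord0 o1 o1 isT isT; have := rel ord0 ord0 o1 ord_max isT isT.
have := rel ord0 o1 o1 ord0 isT isT; have := rel ord0 o1 o1 ord_max isT isT.
have := rel ord0 ord_max o1 ord0 isT isT; have := rel ord0 ord_max o1 o1 isT isT.
have := rel ord0 ord0 ord_max o1 isT isT; have := rel ord0 ord0 ord_max ord_max isT isT.
have := rel ord0 o1 ord_max ord0 isT isT; have := rel ord0 o1 ord_max ord_max isT isT.
have := rel ord0 ord_max ord_max ord0 isT isT; have := rel ord0 ord_max ord_max o1 isT isT.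
have := rel o1 ord0 ord_max o1 isT isT; have := rel o1 ord0 ord_max ord_max isT isT.
have := rel o1 o1 ord_max ord0 isT isT; have := rel o1 o1 ord_max ord_max isT isT.
have := rel o1 ord_max ord_max ord0 isT isT; have := rel o1 ord_max ord_max o1 isT isT.
rewrite (qq ord0 o1) // (qq ord0 ord_max) // (qq o1 ord_max) //.
have addb_eqF a b : a = false -> b = false -> a (+) b = false by move=> -> ->.
(* The 18 relations are added into one whose right side is [false] and whose left side is
   identically [true]. *)
do 17![move=> /addb_eqF H /H {H}].
have -> : addb = xorb by apply/funext => -[]; apply/funext => -[].
move=> E; suff: true = false by []; rewrite -E; symmetry; clear.
by btauto.
Qed.

(** * Compactness: from disjoint arcs to separated sample walks *)

Section UnitInterval.
Local Open Scope ring_scope.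
Local Open Scope classical_set_scope.
Variable R : realType.
Implicit Types (c : R -> R * R) (d e s t x y : R).

Local Notation unit_interval := [set s : R | 0 <= s <= 1].

(** Compactness as a near-covering property, with the filter of right neighbourhoods of 0 as
    parameter. Uniform continuity and the separation of arcs are instances. *)
Lemma unit_interval_compact_uniform (P : R -> R -> Prop) :
  (forall x, 0 <= x <= 1 -> exists2 d, 0 < d &
     forall e y, 0 < e < d -> 0 <= y <= 1 -> `|x - y| < d -> P e y) ->
  exists2 d, 0 < d & forall x, 0 <= x <= 1 -> P d x.
Proof.
move=> H.
have := @segment_compact R 0 1; move=> /compact_near_coveringP/near_covering_withinP.
move=> /(_ R (0:R)^'+ P _).
have : forall x, `[0, 1]%classic x -> \forall x' \near x & i \near (0:R)^'+, `[0, 1]%classic x' -> P i x'.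
  move=> x /=; rewrite in_itv /= => /H[d d0 Hd].
  exists ([set y | `|x - y| < d], [set e | 0 < e < d]) => /=.
    split; first by apply/nbhs_normP; exists d.
    near=> e => /=; apply/andP; split; near: e; [exact: nbhs_right_gt | exact: nbhs_right_lt].
  by move=> [y e] /= [h1 h2]; rewrite in_itv /= => h3; exact: Hd.
move=> C /(_ C) {}C.
near (0:R)^'+ => d; exists d => // x x01.
by apply: (near C d) => //=; rewrite in_itv.
Unshelve. all: by end_near. Qed.

Lemma within_unit_interval_continuousP (c : R -> R * R) :
  {within unit_interval, continuous c} -> forall x, 0 <= x <= 1 ->
  forall e, 0 < e -> exists2 d, 0 < d &
    forall y, 0 <= y <= 1 -> `|x - y| < d -> `|c x - c y| < e.
Proof.
move=> /subspace_continuousP cc x x01 e e0.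
have /cvgrPdist_lt/(_ _ e0) := cc x x01.
rewrite near_withinE => /nbhs_normP[d /= d0 Hd]; exists d => // y y01 xy.
exact: Hd.
Qed.

Lemma unit_interval_unif_continuous (c : R -> R * R) (e : R) : 0 < e ->
  {within unit_interval, continuous c} -> exists2 d, 0 < d &
  forall x y, 0 <= x <= 1 -> 0 <= y <= 1 -> `|x - y| < d -> `|c x - c y| < e.
Proof.
move=> e0 cc.
have [x x01|d d0 Hd] := @unit_interval_compact_uniform (fun d x =>
    forall y, 0 <= y <= 1 -> `|x - y| < d -> `|c x - c y| < e).
  have [|d d0 Hd] := within_unit_interval_continuousP cc x01 (e := e / 2); first lra.
  exists (d / 2); first lra.
  move=> d' y /andP[_ dd'] y01 xy z z01 yz.
  have h1 : `|c x - c y| < e / 2 by apply: Hd => //; lra.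
  have h2 : `|c x - c z| < e / 2.
    apply: Hd => //; apply: le_lt_trans (ler_distD y _ _) _; lra.
  by apply: le_lt_trans (ler_distD (c x) _ _) _; rewrite distrC; lra.
by exists d => // x y x01; exact: Hd.
Qed.

(** Compactness is used first in [t] for a fixed [s], then in [s]. In both rounds a displacement
    below [m / 2] leaves at least half of the bound [m]. *)
Lemma disjoint_arcs_separated (c c' : R -> R * R) :
  {within unit_interval, continuous c} -> {within unit_interval, continuous c'} ->
  (forall s t, 0 <= s <= 1 -> 0 <= t <= 1 -> c s <> c' t) ->
  exists2 d, 0 < d & forall s t, 0 <= s <= 1 -> 0 <= t <= 1 -> d <= `|c s - c' t|.
Proof.
move=> cc cc' dis.
have sep x : 0 <= x <= 1 ->
    exists2 d, 0 < d & forall t, 0 <= t <= 1 -> d <= `|c x - c' t|.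
  move=> x01; apply: (@unit_interval_compact_uniform (fun d t => d <= `|c x - c' t|)).
  move=> t t01; pose m := `|c x - c' t|.
  have m0 : 0 < m by rewrite normr_gt0 subr_eq0; apply/eqP; exact: dis.
  have [|d d0 Hd] := within_unit_interval_continuousP cc' t01 (e := m / 2); first lra.
  exists (Num.min d (m / 2)); first by rewrite lt_min d0; lra.
  move=> e y; rewrite !lt_min => /and3P[e0 ed em] y01 /andP[td tm].
  have := Hd y y01 td; have := ler_distD (c' y) (c x) (c' t).
  by rewrite -/m (distrC (c' y)); lra.
suff [d d0 H] : exists2 d, 0 < d &
    forall s, 0 <= s <= 1 -> forall t, 0 <= t <= 1 -> d <= `|c s - c' t|.
  by exists d => // s t s01; exact: H.
apply: (@unit_interval_compact_uniform
  (fun d s => forall t, 0 <= t <= 1 -> d <= `|c s - c' t|)) => s s01.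
 have [m m0 Hm] := sep s s01.
have [|d d0 Hd] := within_unit_interval_continuousP cc s01 (e := m / 2); first lra.
exists (Num.min d (m / 2)); first by rewrite lt_min d0; lra.
move=> e y; rewrite !lt_min => /and3P[e0 ed em] y01 /andP[sd _] t t01.
have := Hd y y01 sd; have := ler_distD (c y) (c s) (c' t); have := Hm t t01.
by lra.
Qed.

Lemma finite_common_bound (I : finType) (Q : I -> R -> Prop) :
  (forall i d d', 0 < d' -> d' <= d -> Q i d -> Q i d') ->
  (forall i, exists2 d, 0 < d & Q i d) -> exists2 d, 0 < d & forall i, Q i d.
Proof.
move=> mono ex.
have [d d0 Hd] : exists2 d, 0 < d & {in enum I, forall i, Q i d}.
  elim: (enum I) => [|i s [d d0 IH]]; first by exists 1 => // i; rewrite in_nil.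
  have [d' d'0 Hd'] := ex i; have m0 : 0 < Num.min d d' by rewrite lt_min d0.
  exists (Num.min d d') => // j; rewrite inE => /orP[/eqP-> | /IH Qj].
    by apply: mono Hd' => //; rewrite ge_min lexx orbT.
  by apply: mono Qj => //; rewrite ge_min lexx.
by exists d => // i; apply: Hd; rewrite mem_enum.
Qed.

Lemma K33_arcs (p q : 'I_3 -> R * R) (c : 'I_3 -> 'I_3 -> R -> R * R) :
  (forall i j, {within unit_interval, continuous (c i j)}) ->
  (forall i j, c i j 0 = p i) -> (forall i j, c i j 1 = q j) ->
  (forall i j i' j', i != i' -> j != j' -> forall s t, 0 <= s <= 1 -> 0 <= t <= 1 ->
     c i j s <> c i' j' t) ->
  False.
Proof.
move=> cc c0 c1 dis.
have [eps eps0 sep] : exists2 eps, 0 < eps &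
    forall z : ('I_3 * 'I_3) * ('I_3 * 'I_3), z.1.1 != z.2.1 -> z.1.2 != z.2.2 ->
    forall s t, 0 <= s <= 1 -> 0 <= t <= 1 -> eps <= `|c z.1.1 z.1.2 s - c z.2.1 z.2.2 t|.
  apply: finite_common_bound => [z d d' _ dd' H z1 z2 s t s01 t01|[[i j] [i' j']] /=].
    exact: le_trans dd' (H z1 z2 s t s01 t01).
  have [ii|/negP ii] := boolP (i == i'); first by exists 1.
  have [jj|/negP jj] := boolP (j == j'); first by exists 1.
  have [|d d0 H] := disjoint_arcs_separated (cc i j) (cc i' j').
    by apply: dis; apply/negP.
  by exists d.
have [d d0 unif] : exists2 d, 0 < d & forall z : 'I_3 * 'I_3,
    forall x y, 0 <= x <= 1 -> 0 <= y <= 1 -> `|x - y| < d ->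
    `|c z.1 z.2 x - c z.1 z.2 y| < eps / 2.
  apply: finite_common_bound => [z e e' _ ee H x y x01 y01 xy|z].
    by apply: H => //; exact: lt_le_trans ee.
  by apply: unit_interval_unif_continuous; [lra | exact: cc].
(* Since [n] exceeds [d^-1], consecutive sample parameters [k / n] are less than [d] apart. *)
pose n := (Num.trunc d^-1).+1.
have n0 : (0 : R) < n%:R by rewrite ltr0n.
have nd : n%:R^-1 < d.
  rewrite invf_plt ?posrE //; exact: truncnS_gt.
have k01 k : (k <= n)%N -> 0 <= k%:R / n%:R <= (1 : R).
  by move=> kn; rewrite divr_ge0 // ler_pdivrMr // mul1r ler_nat.
apply: (@K33_walks R eps n p q (fun i j k => c i j (k%:R / n%:R))) => //.
- by move=> i j; rewrite mul0r.
- by move=> i j; rewrite divff ?gt_eqF.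
- move=> i j k kn; apply: (unif (i, j)); rewrite ?k01 // ?(ltnW kn) //.
  by rewrite -mulrBl -natr1 opprD addNKr mulN1r normrN ger0_norm // invr_ge0.
- move=> i j i' j' k l ii jj kn ln; by apply: (sep ((i, j), (i', j'))); rewrite ?k01.
Qed.

End UnitInterval.

(** * Planar graphs and K_{3,3} *)

Section PlanarGraphs.
Local Open Scope ring_scope.
Local Notation R := Rdefinitions.R.

(** Planarity confines a common point of two arcs to their ends. For vertex-disjoint edges those
    ends are images of distinct vertices, so the arcs are disjoint. *)
Lemma planar_K33_free (T : finType) (V : {set T}) (adj : T -> T -> Prop)
    (x y : 'I_3 -> T) :
  planar V adj -> injective x -> injective y ->
  (forall i, x i \in V) -> (forall j, y j \in V) ->
  (forall i j, x i != y j) -> (forall i j, adj (x i) (y j)) -> False.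
Proof.
move=> [p [c [pI [arc cross]]]] xI yI xV yV xy xyA.
have A i j := arc _ _ (xV i) (yV j) (xy i j) (xyA i j).
apply: (@K33_arcs R (fun i => p (x i)) (fun j => p (y j)) (fun i j => c (x i) (y j))).
- by move=> i j; have [] := A i j.
- by move=> i j; have [] := A i j.
- by move=> i j; have [] := A i j.
move=> i j i' j' ii jj s t s01 t01 E.
have xx : x i != x i' by rewrite (inj_eq xI).
have yy : y j != y j' by rewrite (inj_eq yI).
have ne : [set x i; y j]%SET != [set x i'; y j']%SET.
  apply/eqP => /setP/(_ (x i)); rewrite !inE eqxx /= => /esym/orP[].
    by rewrite (negbTE xx).
  by rewrite (negbTE (xy _ _)).
have [hs ht] := cross _ _ _ _ (xV i) (yV j) (xV i') (yV j') (xy i j) (xy i' j')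
  (xyA i j) (xyA i' j') ne s t (mem_set s01) (mem_set t01) E.
have [_ _ E0 E1 _] := A i j; have [_ _ E0' E1' _] := A i' j'.
case: hs ht => /eqP hs [] /eqP ht; move: E; rewrite hs ht ?E0 ?E1 ?E0' ?E1' => /pI.
- by move=> /(_ (xV _) (xV _)) /eqP; rewrite (negbTE xx).
- by move=> /(_ (xV _) (yV _)) /eqP; rewrite (negbTE (xy _ _)).
- by move=> /(_ (yV _) (xV _)) /eqP; rewrite eq_sym (negbTE (xy _ _)).
- by move=> /(_ (yV _) (yV _)) /eqP; rewrite (negbTE yy).
Qed.

Lemma planar_set0 (T : finType) (adj : T -> T -> Prop) : planar finset.set0 adj.
Proof.
exists (fun=> 0), (fun _ _ _ => 0); split; first by move=> u v; rewrite finset.in_set0.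
by split=> u v; rewrite ?finset.in_set0 // => u' v'; rewrite finset.in_set0.
Qed.

End PlanarGraphs.

(** * A straight-line drawing *)

Section StraightLineDrawing.
Local Open Scope ring_scope.
Local Open Scope classical_set_scope.

(* A planar straight-line drawing of [K_5] without the edge [{3, 4}]. *)
Definition drawing_point (R : realFieldType) (k : nat) : R * R :=
  match k with
  | 0 => (-1, 0) | 1 => (1, 0) | 2 => (0, 2) | 3 => (0, 1) | _ => (0, 3)
  end.

Definition drawing_edge (R : realFieldType) (i j : nat) (s : R) : R * R :=
  ((1 - s) * (drawing_point R i).1 + s * (drawing_point R j).1,
   (1 - s) * (drawing_point R i).2 + s * (drawing_point R j).2).

(** The points 3 and 4 lie inside and outside the triangle 0, 1, 2; the segment joining them would
    pass through 2. *)
Definition drawn (i j : nat) : bool :=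
  [&& i < 5, j < 5, i != j & ~~ ((2 < i) && (2 < j))]%N.

Lemma drawing_point_inj (R : realFieldType) (i j : nat) : (i < 5)%N -> (j < 5)%N ->
  drawing_point R i = drawing_point R j -> i = j.
Proof.
by case: i => [|[|[|[|[|i]]]]] //; case: j => [|[|[|[|[|j]]]]] //= _ _ [] *; exfalso; lra.
Qed.

Lemma drawing_edge_inj (R : realFieldType) (i j : nat) (s t : R) : drawn i j ->
  drawing_edge i j s = drawing_edge i j t -> s = t.
Proof.
by case: i => [|[|[|[|[|i]]]]] //; case: j => [|[|[|[|[|j]]]]] //= _ [] /=; lra.
Qed.

Lemma drawing_edge_avoids (R : realFieldType) (i j k : nat) (s : R) : drawn i j ->
  (k < 5)%N -> 0 < s < 1 -> drawing_edge i j s <> drawing_point R k.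
Proof.
by case: i => [|[|[|[|[|i]]]]] //; case: j => [|[|[|[|[|j]]]]] //= _;
  case: k => [|[|[|[|[|k]]]]] //= _ /andP[? ?] [] /=; lra.
Qed.

(** The coordinates are affine in [s] and [t], so each pair of edges is a problem of linear
    arithmetic. *)
Lemma drawing_edges_disjoint (R : realFieldType) (i j i' j' : nat) (s t : R) :
  drawn i j -> drawn i' j' ->
  ~~ [|| (i == i') && (j == j') | (i == j') && (j == i')] ->
  0 <= s <= 1 -> 0 <= t <= 1 ->
  drawing_edge i j s = drawing_edge i' j' t ->
  (s = 0 \/ s = 1) /\ (t = 0 \/ t = 1).
Proof.
case: i => [|[|[|[|[|i]]]]] //; case: j => [|[|[|[|[|j]]]]] //= _;
case: i' => [|[|[|[|[|i']]]]] //; case: j' => [|[|[|[|[|j']]]]] //= _ _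
  /andP[? ?] /andP[? ?] [] /= ? ?; first [exfalso; lra |
  split; first [left; lra | right; lra]].
Qed.

Lemma drawing_edge_continuous (R : realType) (i j : nat) :
  continuous (@drawing_edge R i j).
Proof.
have affine (x y : R) : continuous (fun s : R => (1 - s) * x + s * y).
  move=> s; have sub1 : (fun s : R => 1 - s) @ s --> 1 - s.
    by apply: cvgB; [exact: cvg_cst | exact: cvg_id].
  exact: cvgD (cvgM sub1 (cvg_cst x)) (cvgM cvg_id (cvg_cst y)).
by move=> s; apply: cvg_pair (affine _ _ s) (affine _ _ s).
Qed.

Lemma planar_K5_minus_edge (T : finType) (V : {set T}) (adj : T -> T -> Prop)
    (v : 5.-tuple T) :
  {subset V <= v} ->
  (forall i j : 'I_5, (2 < i)%N -> (2 < j)%N -> i != j -> ~ adj (tnth v i) (tnth v j)) ->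
  planar V adj.
Proof.
move=> sV nadj.
have ltV u : u \in V -> (index u v < 5)%N by move/sV; rewrite -index_mem size_tuple.
have indI u w : u \in V -> w \in V -> index u v = index w v -> u = w.
  by move=> /sV uv /sV wv E; rewrite -(nth_index u uv) E nth_index.
have drawnP u w : u \in V -> w \in V -> u != w -> adj u w -> drawn (index u v) (index w v).
  move=> uV wV uw auw; apply/and4P; split; rewrite ?ltV //.
    by apply: contra uw => /eqP/indI->.
  apply/negP => /andP[lu lw].
  apply: (nadj (Ordinal (ltV u uV)) (Ordinal (ltV w wV)) lu lw).
    by apply: contra uw; rewrite -val_eqE /= => /eqP/indI->.
  by rewrite !(tnth_nth u) /= !nth_index ?sV.
exists (fun u => drawing_point Rdefinitions.R (index u v)).
exists (fun u w => drawing_edge (index u v) (index w v)); split; last split.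
- by move=> u w uV wV /drawing_point_inj E; apply: indI => //; apply: E; exact: ltV.
- move=> u w uV wV uw auw; have D := drawnP u w uV wV uw auw; split.
  + exact/continuous_subspaceT/drawing_edge_continuous.
  + by move=> s t _ _; exact: drawing_edge_inj.
  + by rewrite /drawing_edge !subr0 !mul1r !mul0r !addr0 -surjective_pairing.
  + by rewrite /drawing_edge !subrr !mul1r !mul0r !add0r -surjective_pairing.
  + by move=> z s zV s01; apply: drawing_edge_avoids => //; exact: ltV.
- move=> u w u' w' uV wV uV' wV' uw uw' auw auw' ne s t /set_mem s01 /set_mem t01 E.
  have [] := drawing_edges_disjoint (drawnP _ _ uV wV uw auw)
    (drawnP _ _ uV' wV' uw' auw') _ s01 t01 E.
    apply: contra ne => /orP[] /andP[/eqP/indI-> // /eqP/indI->] //.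
    by rewrite finset.setUC.
  by move=> hs ht; split; [case: hs => ->|case: ht => ->]; rewrite eqxx; by [left|right].
Qed.

End StraightLineDrawing.

(** * Edges of the non-F graph *)

Local Open Scope group_scope.

(** The exceptions are the [n] with at most two residues prime to [n]. Otherwise a cyclic group of
    order [n] has a generator other than [r] and [r^-1], used below as a third vertex. *)
Lemma coprime_strictly_between n : (0 < n)%N ->
  n \in [:: 1; 2; 3; 4; 6]%N \/ exists2 k, coprime n k & (1 < k < n.-1)%N.
Proof.
move=> n0; have [|ns] := boolP (n \in _); [by left | right].
move: ns; rewrite !inE !negb_or => /and5P[n1 n2 n3 n4 n6].
have [on|en] := boolP (odd n); first by exists 2; [rewrite coprimen2 | lia].
pose m := n./2; have nm : n = (2 * m)%N by rewrite /m; lia.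
have [om|em] := boolP (odd m).
  exists (m + 2)%N; last lia.
  by rewrite nm coprimeMl coprime2n oddD om /= /coprime gcdnDl -/(coprime _ _) coprimen2.
exists m.+1; last lia.
by rewrite nm coprimeMl coprime2n /= em coprimenS.
Qed.

(** * Copies of S_3 generated by two involutions *)

Lemma invg_involution (gT : finGroupType) (x : gT) : x ^+ 2 = 1 -> x^-1 = x.
Proof. by move=> x2; apply/eqP; rewrite eq_invg_mul -[x * x]/(x ^+ 2) x2. Qed.

(** The subgroup is the product of [<[s * t]>] and [<[s]>], of coprime orders 3 and 2, and [s]
    inverts [s * t]. *)
Lemma card_involutions_gen6 (gT : finGroupType) (s t : gT) :
  s ^+ 2 = 1 -> t ^+ 2 = 1 -> (s * t) ^+ 3 = 1 -> s != 1 -> t != 1 -> s != t ->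
  #|<<[set s; t]>>%g| = 6.
Proof.
move=> s2 t2 st3 s1 t1 st.
have os : #[s] = 2 by exact: nt_prime_order.
have ot : #[t] = 2 by exact: nt_prime_order.
have sV := invg_involution s2.
have tV := invg_involution t2.
have or : #[s * t] = 3.
  by apply: nt_prime_order => //; rewrite -eq_invg_mul sV.
have gE : <<[set s; t]>> = <[s * t]> <*> <[s]>.
  have rJ : s * t \in <[s * t]> <*> <[s]> by rewrite mem_gen // inE cycle_id.
  have sJ : s \in <[s * t]> <*> <[s]> by rewrite mem_gen // inE cycle_id orbT.
  apply/eqP; rewrite eqEsubset; apply/andP; split.
    by rewrite gen_subG subUset !sub1set sJ /= -(groupMl t sJ).
  by rewrite join_subG !cycle_subG groupM ?mem_gen ?set21 ?set22.
rewrite gE norm_joinEr; last first.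
    rewrite cycle_subG inE -cycleJ cycle_subG conjgE -(mulgA s) mulKg.
    have -> : t * s = (s * t)^-1 by rewrite invMg sV tV.
    by rewrite groupV cycle_id.
by rewrite coprime_cardMg -!orderE ?or ?os.
Qed.

Lemma isog_involutions_gen6 (gT rT : finGroupType) (s t : gT) (s' t' : rT) :
  s ^+ 2 = 1 -> t ^+ 2 = 1 -> (s * t) ^+ 3 = 1 -> s != 1 -> t != 1 -> s != t ->
  s' ^+ 2 = 1 -> t' ^+ 2 = 1 -> (s' * t') ^+ 3 = 1 -> s' != 1 -> t' != 1 -> s' != t' ->
  <<[set s; t]>> \isog <<[set s'; t']>>.
Proof.
move=> s2 t2 st3 s1 t1 st s2' t2' st3' s1' t1' st'.
have ord2 (hT : finGroupType) (u : hT) : u ^+ 2 = 1 -> u != 1 -> #[u] = 2.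
  by move=> u2 u1; exact: nt_prime_order.
have := involutions_gen_dihedral (ord2 _ _ s2 s1) (ord2 _ _ t2 t1) st.
have := involutions_gen_dihedral (ord2 _ _ s2' s1') (ord2 _ _ t2' t1') st'.
rewrite /= !card_involutions_gen6 // => iso' iso; apply: isog_trans iso _.
by rewrite isog_sym.
Qed.

Lemma isog_S3 (gT : finGroupType) (s t : gT) :
  s ^+ 2 = 1 -> t ^+ 2 = 1 -> (s * t) ^+ 3 = 1 -> s != 1 -> t != 1 -> s != t ->
  <<[set s; t]>> \isog [set: {perm 'I_3}].
Proof.
move=> s2 t2 st3 s1 t1 st.
pose o1 : 'I_3 := Ordinal (isT : 1 < 3)%N.
pose u : {perm 'I_3} := tperm ord0 o1; pose v : {perm 'I_3} := tperm o1 ord_max.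
have u2 : u ^+ 2 = 1 by rewrite expgS expg1 tperm2.
have v2 : v ^+ 2 = 1 by rewrite expgS expg1 tperm2.
have u1 : u != 1 by apply/eqP => /permP/(_ ord0); rewrite perm1 tpermL.
have v1 : v != 1 by apply/eqP => /permP/(_ o1); rewrite perm1 tpermL.
have uv : u != v by apply/eqP => /permP/(_ ord0); rewrite tpermL tpermD.
have uv3 : (u * v) ^+ 3 = 1.
  apply/permP => i; rewrite !expgS expg0 mulg1 !permM perm1 /u /v !permE /=.
  by case: i => [[|[|[|i]]] Hi]; apply/val_inj.
have <- : <<[set u; v]>> = [set: {perm 'I_3}].
  apply/eqP; rewrite eqEcard subsetT card_involutions_gen6 //.
  by rewrite cardsT card_Sn.
exact: isog_involutions_gen6.
Qed.

Section NonFGraph.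

Variable F : group_class.
Hypotheses (hF : formation F) (hher : hereditary F) (hN : contains_nilpotent F).

Lemma class_homg (gT rT : finGroupType) (G : {group gT}) (H : {group rT}) :
  H \homg G -> F G -> F H.
Proof.
case/homgP=> f fG FG; have -> : H = (f @* G)%G by apply/group_inj.
exact: hF.1.
Qed.

Lemma class_isog (gT rT : finGroupType) (G : {group gT}) (H : {group rT}) :
  G \isog H -> F G -> F H.
Proof. by rewrite isog_sym => /isog_hom; exact: class_homg. Qed.

Section Adjacency.

Variable gT : finGroupType.
Implicit Types (x y z g h r s t u v w a b : gT) (K : {group gT}).

Local Notation adj := (@GammaAdj F gT).

Lemma adj_gen x y x' y' : x \in <<[set x'; y']>> -> y \in <<[set x'; y']>> ->
  adj x y -> adj x' y'.
Proof.
move=> xg yg nF FK; apply: nF; apply: hher FK.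
by rewrite gen_subG subUset !sub1set xg.
Qed.

Lemma mem_gen2l x y : x \in <<[set x; y]>>. Proof. by rewrite mem_gen ?set21. Qed.
Lemma mem_gen2r x y : y \in <<[set x; y]>>. Proof. by rewrite mem_gen ?set22. Qed.

Lemma adjC x y : adj x y -> adj y x.
Proof. by apply: adj_gen; [exact: mem_gen2r | exact: mem_gen2l]. Qed.

Lemma adjV x y : adj x y -> adj x^-1 y.
Proof. by apply: adj_gen; rewrite ?mem_gen2r // -groupV mem_gen2l. Qed.

Lemma adjM x y : adj x y -> adj x (x * y).
Proof.
apply: adj_gen; rewrite ?mem_gen2l // -[in X in X \in _](mulKg x y).
by rewrite groupM ?groupV ?mem_gen2l ?mem_gen2r.
Qed.

Lemma adjMr x y : adj x y -> adj x (y * x).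
Proof.
apply: adj_gen; rewrite ?mem_gen2l // -[in X in X \in _](mulgK x y).
by rewrite groupM ?groupV ?mem_gen2l ?mem_gen2r.
Qed.

Lemma adj_not_commute x y : adj x y -> x * y != y * x.
Proof.
move=> nF; apply/eqP => cxy; apply: nF; apply/hN/abelian_nil.
rewrite /= abelian_gen abelianE subUset !sub1set; apply/andP; split; apply/centP => z;
  by rewrite !inE => /orP[] /eqP->.
Qed.

Lemma adj_neq1 x y : adj x y -> x != 1.
Proof. by move/adj_not_commute; apply: contraNneq => ->; rewrite mulg1 mul1g. Qed.

Lemma adj_neq x y : adj x y -> x != y.
Proof. by move/adj_not_commute; apply: contraNneq => ->. Qed.

Lemma adj_neqV x y : adj x y -> x^-1 != y.
Proof. by move/adjV/adj_neq. Qed.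

Lemma adj_not_2group x y : adj x y -> 2.-elt x -> 2.-elt y ->
  y \in 'N(<[x]>) -> False.
Proof.
move=> nF px py nxy; apply/nF/hN/(@pgroup_nil _ 2).
have -> : <<[set x; y]>>%G = (<[x]> <*> <[y]>)%G.
  by apply/group_inj; rewrite /= joing_idl joing_idr.
rewrite /= norm_joinEr ?cycle_subG //.
by rewrite pgroupM; apply/andP.
Qed.

Variable G : {group gT}.
(** This is all that planarity contributes to the group theory. Adjacency itself makes the two sides
    disjoint and their elements vertices. *)
Hypothesis noK33 : forall x1 x2 x3 y1 y2 y3,
  all (mem G) [:: x1; x2; x3; y1; y2; y3] ->
  uniq [:: x1; x2; x3] -> uniq [:: y1; y2; y3] ->
  [/\ adj x1 y1, adj x1 y2 & adj x1 y3] ->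
  [/\ adj x2 y1, adj x2 y2 & adj x2 y3] ->
  [/\ adj x3 y1, adj x3 y2 & adj x3 y3] -> False.

(** Among [x * y], [x * y^-1], [y * x] the only coincidence left open is [x * y^-1 = y * x], which
    is the asserted relation. Without it these elements and [x], [x^-1], [y] would form a
    K_{3,3}. *)
Lemma adj_quaternion_relation x y : x \in G -> y \in G -> adj x y ->
  x ^+ 2 != 1 -> y ^+ 2 != 1 -> x = y * x * y.
Proof.
move=> xG yG xy x2 y2; apply/eqP/negP => /negP nq.
have yx := adjC xy.
have A1 := adjM xy; have A2 := adjM (adjC (adjV yx)); have A3 := adjMr xy.
apply: (@noK33 x x^-1 y (x * y) (x * y^-1) (y * x)).
- by rewrite /= !groupM ?groupV ?xG ?yG.
- rewrite /= !inE negb_or (adj_neq xy) (adj_neqV xy) !andbT.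
  by apply: contra x2 => /eqP E; rewrite expgS expg1 {2}E mulgV.
- rewrite /= !inE negb_or (adj_not_commute xy) !andbT; apply/andP; split.
    by apply: contra y2 => /eqP/mulgI E; rewrite expgS expg1 {2}E mulgV.
  by apply: contra nq => /eqP <-; rewrite mulgKV.
- by split.
- by split; exact: adjV.
- split; [exact: adjMr | | exact: adjM].
  by rewrite -[y in adj y _]invgK; apply: adjV; apply: adjMr; exact: adjV.
Qed.

Lemma adj_involution x y : x \in G -> y \in G -> adj x y ->
  x ^+ 2 = 1 \/ y ^+ 2 = 1.
Proof.
move=> xG yG xy; have [/eqP|x2] := boolP (x ^+ 2 == 1); first by left.
have [/eqP|y2] := boolP (y ^+ 2 == 1); first by right.
have yx := adjC xy.
have Ex := adj_quaternion_relation xG yG xy x2 y2.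
have Ey := adj_quaternion_relation yG xG yx y2 x2.
have conj_inv (u v : gT) : u = v * u * v -> v ^ u = v^-1.
  move=> E; apply: invg_inj; rewrite -conjVg conjgE invgK.
  by apply: (mulgI u); rewrite mulKVg; apply: (mulgI v); rewrite mulKVg mulgA.
have cxy := conj_inv _ _ Ey; have cyx := conj_inv _ _ Ex.
(* The commutator is [x^-1 * x ^ y = x ^- 2], and also [(y^-1) ^ x * y = y ^+ 2]. *)
have xy2 : y ^+ 2 = x ^- 2.
  have := erefl [~ x, y]; rewrite {1}commgEl commgEr conjVg cxy cyx invgK => E.
  by rewrite (expgS y) expg1 -E (expgS x) expg1 invMg.
have x4 : x ^+ 4 = 1.
  have : (x ^+ 2) ^ y = x ^+ 2.
    by rewrite -[x ^+ 2]invgK -xy2 conjVg conjXg conjgE mulKg.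
  rewrite conjXg cxy expgVn => /eqP; rewrite eq_invg_mul => /eqP E.
  by rewrite -E -expgD.
have y4 : y ^+ 4 = 1 by rewrite (expgM y 2 2) xy2 expgVn -expgM x4 invg1.
have p2 (u : gT) : u ^+ 4 = 1 -> 2.-elt u.
  move=> u4; apply: (@pnat_dvd _ (2 ^ 2)); first by rewrite order_dvdn u4.
  by rewrite pnatX pnat_id.
case: (adj_not_2group xy (p2 _ x4) (p2 _ y4)).
by rewrite inE -cycleJ cycle_subG cxy groupV cycle_id.
Qed.

(** * Edges between two involutions: the order of their product *)

Section DihedralEdge.
Variables x y : gT.
Hypotheses (xG : x \in G) (yG : y \in G) (xy : adj x y).
Hypotheses (x2 : x ^+ 2 = 1) (y2 : y ^+ 2 = 1).

Let r := x * y.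
Let xx : x * x = 1. Proof. by rewrite -x2 expgS expg1. Qed.
Let yE : y = x * r. Proof. by rewrite /r mulgA xx mul1g. Qed.
Let xV : x^-1 = x. Proof. exact: invg_involution. Qed.
Let yV : y^-1 = y. Proof. exact: invg_involution. Qed.
Let rx : r ^ x = r^-1.
Proof. by rewrite conjgE /r invMg xV yV !mulgA xx mul1g. Qed.
Let rG : r \in G. Proof. by rewrite groupM. Qed.

(** A reflection [x * r ^+ i] and a generator [r ^+ k] of the rotations generate the whole dihedral
    group. *)
Let adj_rotation i k : coprime #[r] k -> adj (x * r ^+ i) (r ^+ k).
Proof.
rewrite -generator_coprime => /eqP gk; move: xy; apply: adj_gen.
all: set K := <<_>>.
all: have rK : r \in K.
1,3: by rewrite -cycle_subG gk cycle_subG mem_gen2r.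
all: have xK : x \in K.
1,3: by rewrite -(mulgK (r ^+ i) x) groupM ?mem_gen2l // groupV groupX.
by [].
by rewrite yE groupM.
Qed.

Let rotation_neq i k : (i < #[r])%N -> (k < #[r])%N -> i != k -> r ^+ i != r ^+ k.
Proof. by move=> hi hk; rewrite eq_expg_mod_order !modn_small. Qed.

Let order_rotation : #[r] \in [:: 1; 2; 3; 4; 6]%N.
Proof.
have [//|[k cop kn]] := coprime_strictly_between (order_gt0 r).
have n3 : (3 < #[r])%N by lia.
exfalso; apply: (@noK33 x (x * r) (x * r ^+ 2) r (r ^+ #[r].-1) (r ^+ k)).
- by rewrite /= !groupM ?groupX ?xG ?yG.
- rewrite -[x in [:: x; _; _]]mulg1 -[1]/(r ^+ 0) -[r in [:: _; x * r; _]]expg1 /= !inE.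
  by rewrite !(inj_eq (mulgI x)) negb_or !rotation_neq //; lia.
- rewrite -[r in [:: r; _; _]]expg1 /= !inE negb_or !rotation_neq //; lia.
all: rewrite -[adj _ r]/(adj _ (r ^+ 1)).
all: have copV : coprime #[r] #[r].-1 by rewrite coprimenP.
- by split; rewrite -[x in adj x _]mulg1 -[1]/(r ^+ 0); apply: adj_rotation; rewrite ?coprimen1.
- by split; apply: (@adj_rotation 1); rewrite ?coprimen1.
- by split; apply: adj_rotation; rewrite ?coprimen1.
Qed.

(** Here [H] is the direct product of [S] and the central subgroup [N]. If [S] is in [F], then so
    are [H / N], an image of [S], and [H / S], an image of [N], hence also [H], against [xy]. *)
Let order_rotation_neq6 : #[r] != 6%N.
Proof.
apply/eqP => r6.
pose S := <<[set x; r ^+ 2]>>%G; pose N := <[r ^+ 3]>%G; pose H := <<[set x; y]>>%G.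
have rH : r \in H by rewrite groupM ?mem_gen2l ?mem_gen2r.
have genH (K : {group gT}) : x \in K -> r \in K -> H \subset K.
  by move=> xK rK; rewrite gen_subG subUset !sub1set xK /= yE groupM.
have rr : x ^ r = x * r ^+ 2.
  by rewrite conjgE -yE (expgS r) expg1 mulgA -yE /r invMg xV yV mulgA.
have FS : F S.
{ apply: contrapT => nFS.
  (* [r ^+ 2] does not generate the rotations; its edges to three reflections come from [S] not
     being in [F]. *)
  have adjS i : adj (x * (r ^+ 2) ^+ i) (r ^+ 2).
    move: nFS; apply: adj_gen; last exact: mem_gen2r.
    set K := <<_>>; by rewrite -(mulgK ((r ^+ 2) ^+ i) x) groupM ?mem_gen2l // groupV groupX ?mem_gen2r.
  apply: (@noK33 x (x * r ^+ 2) (x * r ^+ 4) r (r ^+ 5) (r ^+ 2)).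
  - by rewrite /= !groupM ?groupX ?xG ?yG.
  - rewrite -[x in [:: x; _; _]]mulg1 -[1]/(r ^+ 0) /= !inE.
    by rewrite !(inj_eq (mulgI x)) negb_or !rotation_neq // r6.
  - by rewrite -[r in [:: r; _; _]]expg1 /= !inE negb_or !rotation_neq ?r6.
  all: rewrite -[adj _ r]/(adj _ (r ^+ 1)).
  - split; rewrite -[x in adj x _]mulg1 -[1]/(r ^+ 0); try by apply: adj_rotation; rewrite r6.
    exact: (adjS 0%N).
  - split; try by apply: adj_rotation; rewrite r6.
    exact: (adjS 1%N).
  - split; try by apply: adj_rotation; rewrite r6.
    by have := adjS 2%N; rewrite -expgM. }
have r2S : r ^+ 2 \in S by exact: mem_gen2r.
have xS : x \in S by exact: mem_gen2l.
have r3N : r ^+ 3 \in N by exact: cycle_id.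
have SH : S \subset H.
  by rewrite gen_subG subUset !sub1set mem_gen2l groupX.
have nSH : H \subset 'N(S).
  apply: genH; first by rewrite (subsetP (normG S)).
  rewrite inE -genJ gen_subG conjUg !conjg_set1 subUset !sub1set rr.
  by rewrite groupM // conjXg conjgE mulKg.
have nNH : H \subset 'N(N).
  apply/(subset_trans _ (cent_sub N))/genH; rewrite /= /N /= cent_cycle; apply/cent1P/commute_sym.
    apply/commgP/conjg_fixP; rewrite conjXg rx expgVn; apply/eqP.
    by rewrite eq_invg_mul -expgD -order_dvdn r6.
  exact/commute_sym/commuteX.
(* [N] has order 2. If it lay in [S], then [r ^+ 2] and [r ^+ 3] would put [r], hence all of [H],
   into [S]. *)
have TI : N :&: S = 1.
  apply: prime_TIg; first by rewrite -orderE orderXdiv ?r6.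
  rewrite cycle_subG; apply/negP => r3S; apply: xy; apply: hher FS; apply: genH => //.
  by rewrite -(mulKg (r ^+ 2) r) groupM ?groupV // -expgSr.
have HSN : H :=: S <*> N.
  apply/eqP; rewrite eqEsubset join_subG SH cycle_subG groupX // !andbT.
  apply: genH; first by rewrite mem_gen // inE xS.
  rewrite -(mulKg (r ^+ 2) r) groupM ?groupV // -?expgSr mem_gen // inE ?r2S ?r3N ?orbT //.
have nSN : S \subset 'N(N) := subset_trans SH nNH.
have nNS : N \subset 'N(S) by apply: subset_trans nSH; rewrite cycle_subG groupX.
have F1 : F (H / N)%G.
  have -> : (H / N)%G = (S / N)%G by apply/group_inj; rewrite /= HSN quotientYidr.
  apply: class_homg FS; exact: quotient_homg.
have F2 : F (H / S)%G.
  have -> : (H / S)%G = (N / S)%G by apply/group_inj; rewrite /= HSN quotientYidl.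
  by apply/hN/abelian_nil/quotient_abelian/cycle_abelian.
have nN : normal N H by rewrite /normal nNH andbT HSN joing_subr.
have nS : normal S H by rewrite /normal nSH SH.
have := hF.2 _ _ _ _ nN nS F1 F2; rewrite TI => F3.
by apply: xy; apply: class_isog F3; rewrite isog_sym quotient1_isog.
Qed.

Lemma adj_involutions : (x * y) ^+ 3 = 1.
Proof.
(* Orders 1, 2 and 4 are treated together: [r] and [x] then generate a 2-group. *)
have [/eqP r4|r4] := boolP (r ^+ 4 == 1); last first.
  have := order_rotation; rewrite !inE (negbTE order_rotation_neq6) orbF.
  by case/or4P => /eqP o; rewrite -/r; apply/eqP; rewrite -order_dvdn ?o //;
    move: r4; rewrite -order_dvdn o.
case: (@adj_not_2group r x).
- exact/adjC/adjM.
- apply: (@pnat_dvd _ (2 ^ 2)); first by rewrite order_dvdn r4.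
  by rewrite pnatX pnat_id.
- by apply: (@pnat_dvd _ 2); rewrite ?pnat_id // order_dvdn x2.
- by rewrite inE -cycleJ cycle_subG rx groupV cycle_id.
Qed.

End DihedralEdge.

(** If only [x] is an involution, the edge between [y] and [x * y] makes [x * y] an involution too,
    and [adj_involutions] applies to [x] and [x * y], whose product is [y]. *)
Lemma adj_cases x y : x \in G -> y \in G -> adj x y ->
  [\/ [/\ x ^+ 2 = 1, y ^+ 2 = 1 & (x * y) ^+ 3 = 1],
      [/\ x ^+ 2 = 1, y ^+ 3 = 1 & (x * y) ^+ 2 = 1] |
      [/\ x ^+ 3 = 1, y ^+ 2 = 1 & (x * y) ^+ 2 = 1]].
Proof.
move=> xG yG xy; have xyG : x * y \in G by rewrite groupM.
have xxy := adjM xy; have yxy := adjMr (adjC xy).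
have [/eqP x2|x2] := boolP (x ^+ 2 == 1); have [/eqP y2|y2] := boolP (y ^+ 2 == 1).
- by apply: Or31; split=> //; exact: adj_involutions.
- have [E|xy2] := adj_involution yG xyG yxy; first by rewrite E eqxx in y2.
  apply: Or32; split=> //; have := adj_involutions xG xyG xxy x2 xy2.
  by rewrite mulgA -[x * x]/(x ^+ 2) x2 mul1g.
- have [E|xy2] := adj_involution xG xyG xxy; first by rewrite E eqxx in x2.
  apply: Or33; split=> //; have := adj_involutions xyG yG (adjC yxy) xy2 y2.
  by rewrite -mulgA -[y * y]/(y ^+ 2) y2 mulg1.
- by case: (adj_involution xG yG xy) => E; [rewrite E eqxx in x2 | rewrite E eqxx in y2].
Qed.

Lemma IF_notin_adj g : g \in G -> g \notin IF F G -> exists2 h, h \in G & adj g h.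
Proof.
move=> gG; rewrite inE gG /= => /asboolPn/existsNP[h /not_implyP[hG nF]].
by exists h.
Qed.

Lemma adj_IF g h : h \in G -> adj g h -> g \notin IF F G.
Proof. by move=> hG gh; rewrite inE; apply/nandP; right; apply/asboolPn => /(_ h hG). Qed.

Lemma IF_conjg z g : z \in IF F G -> g \in G -> z ^ g \in IF F G.
Proof.
rewrite !inE => /andP[zG /asboolP Fz] gG; rewrite groupJ //=; apply/asboolP => h hG.
have := Fz (h ^ g^-1); rewrite groupJ ?groupV // => /(_ isT).
apply: class_isog; have -> : <<[set z ^ g; h]>>%G = (<<[set z; h ^ g^-1]>> :^ g)%G.
  by apply/group_inj; rewrite /= -genJ conjUg !conjg_set1 conjgKV.
exact: conj_isog.
Qed.

Hypothesis IF_group : group_set (IF F G).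

(** * The group around an edge between two involutions *)

Section SymmetricEdge.
Variables a b : gT.
Hypotheses (aG : a \in G) (bG : b \in G) (ab : adj a b).
Hypotheses (a2 : a ^+ 2 = 1) (b2 : b ^+ 2 = 1) (ab3 : (a * b) ^+ 3 = 1).

Let I := Group IF_group.
Let r := a * b.
Let rG : r \in G. Proof. exact: groupM. Qed.
Let a1 : a != 1. Proof. exact: adj_neq1 ab. Qed.
Let b1 : b != 1. Proof. exact: adj_neq1 (adjC ab). Qed.
Let adj_ra : adj r a. Proof. exact/adjC/adjM. Qed.
Let adj_rb : adj r b. Proof. exact/adjC/adjMr/adjC. Qed.

(** Both pairs generate isomorphic groups, so the edge [ab] excludes every such copy of S_3 from
    [F]. *)
Lemma adj_S3 s t : s ^+ 2 = 1 -> t ^+ 2 = 1 -> (s * t) ^+ 3 = 1 ->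
  s != 1 -> t != 1 -> s != t -> adj s t.
Proof.
move=> s2 t2 st3 s1 t1 st Fst; apply: ab; apply: class_isog Fst.
by apply: isog_involutions_gen6 => //; exact: adj_neq.
Qed.

Lemma expg_notin_IF g : g \in G -> g \notin I -> g ^+ 2 = 1 \/ g ^+ 3 = 1.
Proof.
move=> gG /(IF_notin_adj gG)[h hG /(adj_cases gG hG)].
by case=> -[? ? ?]; [left | left | right].
Qed.

(** As [I] is a subgroup, [z * g] lies outside it and has square or cube 1. The square is
    [z * z ^ g]; a trivial cube would put [g] into [I]. *)
Lemma IF_inverted z g : z \in I -> g \in G -> g \notin I -> g ^+ 2 = 1 -> z ^ g = z^-1.
Proof.
move=> zI gG gI g2.
have zG : z \in G by move: zI; rewrite inE => /andP[].
have gV := invg_involution g2.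
have zgI : z ^ g \in I by exact: IF_conjg.
have zg2 : (z * g) ^+ 2 = z * z ^ g.
  by rewrite expgS expg1 conjgE gV !mulgA.
have zgnI : z * g \notin I by rewrite groupMl.
case: (expg_notin_IF (groupM zG gG) zgnI) => E.
  by apply/esym/eqP; rewrite eq_invg_mul -zg2 E.
case/negP: gI; have : z * z ^ g * (z * g) = 1 by rewrite -zg2 -expgSr E.
rewrite mulgA => /eqP; rewrite -eq_invg_mul => /eqP <-; rewrite groupV.
exact: groupM (groupM zI zgI) zI.
Qed.

(** Both [a] and [b] invert [z], so [r] centralises it, and the order of [z * r] forces
    [z ^+ 3 = 1]. If [z != 1], the involutions [a] and [a * z] have product [z] of order 3 and are
    adjacent, so [z] is adjacent to [a]. *)
Lemma IF_trivial z : z \in I -> z = 1.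
Proof.
move=> zI; have zG : z \in G by move: zI; rewrite inE => /andP[].
have aI : a \notin I := adj_IF bG ab.
have bI : b \notin I := adj_IF aG (adjC ab).
have rI : r \notin I := adj_IF aG adj_ra.
have za := IF_inverted zI aG aI a2.
have zr : commute z r.
  by apply/commgP/conjg_fixP; rewrite conjgM za conjVg (IF_inverted zI bG bI b2) invgK.
have z3 : z ^+ 3 = 1.
  have zrnI : z * r \notin I by rewrite groupMl.
  case: (expg_notin_IF (groupM zG rG) zrnI); rewrite expgMn // => E; last first.
    by rewrite ab3 mulg1 in E.
  case/negP: rI; have -> : r = (r ^+ 2) ^+ 2 by rewrite -expgM (expgSr r 3) ab3 mul1g.
  move/eqP: E; rewrite -eq_invg_mul => /eqP <-.
  by rewrite groupX // groupV groupX.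
apply/eqP/negP => /negP z1.
have az2 : (a * z) ^+ 2 = 1.
  have aV := invg_involution a2.
  by move: za; rewrite conjgE aV mulgA => za; rewrite expgS expg1 mulgA za mulVg.
have aaz : a * (a * z) = z by rewrite mulgA -[a * a]/(a ^+ 2) a2 mul1g.
have : adj a (a * z).
  apply: adj_S3; rewrite ?aaz //.
    by apply: contraNneq aI => E; rewrite -(groupMr _ zI) E group1.
  by apply: contraNneq z1 => E; rewrite -aaz -E -[a * a]/(a ^+ 2) a2.
move/adjM; rewrite aaz => /adjC/(adj_IF aG).
by rewrite zI.
Qed.

Lemma neq1_adj g : g \in G -> g != 1 -> exists2 h, h \in G & adj g h.
Proof. by move=> gG g1; apply: IF_notin_adj => //; apply: contraNN g1 => /IF_trivial->. Qed.

Lemma expg_2or3 g : g \in G -> g ^+ 2 = 1 \/ g ^+ 3 = 1.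
Proof.
move=> gG; have [->|g1] := eqVneq g 1; first by left; rewrite expg1n.
by apply: expg_notin_IF => //; apply: contraNN g1 => /IF_trivial->.
Qed.

Lemma commute_involution t g : t \in G -> g \in G -> t ^+ 2 = 1 -> t != 1 ->
  g ^+ 3 = 1 -> g != 1 -> commute t g -> False.
Proof.
move=> tG gG t2 t1 g3 g1 tg; case: (@expg_2or3 (t * g)); rewrite ?groupM // expgMn //.
  rewrite t2 mul1g => g2; case/eqP: g1.
  by rewrite -(mulKg (g ^+ 2) g) -expgSr g2 g3 invg1 mulg1.
by rewrite g3 mulg1 expgS t2 mulg1 => /eqP; exact/negP.
Qed.

Lemma commute_or_braid t u : t \in G -> u \in G -> t ^+ 2 = 1 -> u ^+ 2 = 1 ->
  commute t u \/ (t * u) ^+ 3 = 1.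
Proof.
move=> tG uG t2 u2; case: (@expg_2or3 (t * u)); rewrite ?groupM //; last by right.
rewrite expgS expg1 => /eqP; rewrite -eq_invg_mul invMg => /eqP E; left.
have invol := @invg_involution gT.
by rewrite /commute -E !invol.
Qed.

(* [t], [u], [s] satisfy the Coxeter relations of [S_4], in which [t * s * u] is a 4-cycle. *)
Lemma no_S4_relations t s u : t \in G -> s \in G -> u \in G ->
  t ^+ 2 = 1 -> s ^+ 2 = 1 -> u ^+ 2 = 1 -> t != s -> commute t s ->
  (t * u) ^+ 3 = 1 -> (s * u) ^+ 3 = 1 -> s * u != 1 -> False.
Proof.
move=> tG sG uG t2 s2 u2 ts cts tu3 su3 su1.
have invol := @invg_involution gT.
have braid (v w : gT) : v ^+ 2 = 1 -> w ^+ 2 = 1 -> (v * w) ^+ 3 = 1 -> v * (w * v) = w * (v * w).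
  move=> v2 w2 E; apply/eqP; rewrite -(invol v) // -(invol w) // -2!invMg eq_invg_mul.
  by rewrite !invol // -E !expgS expg0 mulg1 !mulgA.
(* The arbitrary tail [z] lets the relations rewrite inside right-associated words. *)
have tuL z : t * (u * (t * z)) = u * (t * (u * z)).
  by have := braid _ _ t2 u2 tu3 => E; rewrite !mulgA -(mulgA t) E !mulgA.
have suL z : s * (u * (s * z)) = u * (s * (u * z)).
  by have := braid _ _ s2 u2 su3 => E; rewrite !mulgA -(mulgA s) E !mulgA.
have tsL z : t * (s * z) = s * (t * z) by rewrite !mulgA cts.
pose v := t * s.
have v2 : v ^+ 2 = 1 by rewrite expgMn // t2 s2 mulg1.
have v1 : v != 1 by rewrite /v -eq_invg_mul invol.
have vG : v \in G by rewrite groupM.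
have ncvu : ~ commute v u.
  move=> cvu; apply: (@commute_involution v (s * u)); rewrite ?groupM //.
  by apply: commuteM => //; exact: commute_sym (commuteM (commute_sym cts) (commute_refl s)).
have [//|vu3] := commute_or_braid vG uG v2 u2.
(* The right side is the inverse of the left, so [(v * u) ^+ 4 = 1]; with [vu3] this gives
   [v * u = 1]. *)
have sq : v * u * (v * u) = u * v * (u * v).
  rewrite /v -!mulgA tsL tuL -(braid s u) // tsL suL.
  by rewrite -(tuL s) -tsL.
clearbody v.
have sqV : (v * u) ^+ 2 = ((v * u) ^+ 2)^-1.
  by rewrite expgS expg1 [LHS]sq !invMg (invol v v2) (invol u u2).
have vu4 : (v * u) ^+ 4 = 1.
  by rewrite (expgM _ 2 2) expgS expg1 {1}sqV mulVg.
apply: ncvu; move: vu4; rewrite expgS vu3 mulg1 => /eqP; rewrite -eq_invg_mul => /eqP <-.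
exact/commuteV/commute_refl.
Qed.

(** The third involution of [<<[set a; b]>>]. *)
Let c := a * b * a.
Let rV : r^-1 = b * a. Proof. by rewrite invMg !invg_involution. Qed.
Let cG : c \in G. Proof. by rewrite !groupM. Qed.
Let c2 : c ^+ 2 = 1.
Proof.
by rewrite expgS expg1 /c -!mulgA (mulgA a a) -[a * a]/(a ^+ 2) a2 mul1g (mulgA b b)
  -[b * b]/(b ^+ 2) b2 mul1g.
Qed.
Let caE : c * a = r. Proof. by rewrite /c -!mulgA -[a * a]/(a ^+ 2) a2 mulg1. Qed.
Let acE : a * c = r^-1. Proof. by rewrite rV /c !mulgA -[a * a]/(a ^+ 2) a2 mul1g. Qed.
Let rV3 : r^-1 ^+ 3 = 1. Proof. by rewrite expgVn ab3 invg1. Qed.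
Let bcE : b * c = r.
Proof.
have -> : b * c = r^-1 ^+ 2 by rewrite rV expgS expg1 /c !mulgA.
by rewrite -(mulKg (r^-1) (r^-1 ^+ 2)) -expgS rV3 invgK mulg1.
Qed.
Let r1 : r != 1. Proof. exact: adj_neq1 adj_ra. Qed.
Let rV1 : r^-1 != 1. Proof. by rewrite invg_eq1. Qed.
Let r2 : r ^+ 2 != 1.
Proof.
by apply: contraNneq r1 => E; move: ab3; rewrite expgSr -/r E mul1g => ->.
Qed.
Let adj_rc : adj r c. Proof. exact: adjM adj_ra. Qed.
Let c1 : c != 1. Proof. exact: adj_neq1 (adjC adj_rc). Qed.

(** Let [t] be another involution. If it commutes with two of [a], [b], [c], it centralises their
    product of order 3; if with exactly one, the S_4 relations arise; if with none, [r], [r^-1], [t]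
    against [a], [b], [c] is a K_{3,3}. *)
Lemma involution_S3 t : t \in G -> t ^+ 2 = 1 -> t != 1 -> t \in [:: a; b; c].
Proof.
move=> tG t2 t1; apply: contraT; rewrite !inE !negb_or => /and3P[ta tb tc].
have comm2 u v : u \in G -> v \in G -> u * v = r \/ u * v = r^-1 ->
    commute t u -> commute t v -> False.
  move=> uG vG uv cu cv; apply: (@commute_involution t (u * v)); rewrite ?groupM //.
  - by case: uv => ->.
  - by case: uv => ->.
  - exact: commuteM.
have S4 s u := @no_S4_relations t s u tG.
have ba3 : (b * a) ^+ 3 = 1 by rewrite -rV.
case: (commute_or_braid tG aG t2 a2) => Ha; case: (commute_or_braid tG bG t2 b2) => Hb;
  case: (commute_or_braid tG cG t2 c2) => Hc; exfalso.
- by apply: (comm2 a b) => //; left.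
- by apply: (comm2 a b) => //; left.
- by apply: (comm2 a c) => //; right.
- by apply: (S4 a b).
- by apply: (comm2 b c) => //; left.
- by apply: (S4 b a) => //; rewrite -rV.
- by apply: (S4 c a) => //; rewrite caE.
apply: (@noK33 r r^-1 t a b c).
- by rewrite /= groupV rG tG aG bG cG.
- rewrite /= !inE negb_or andbT -andbA; apply/and3P; split=> //.
  + by apply: contra r2 => /eqP E; rewrite expgS expg1 {2}E mulgV.
  + by apply: contraNneq r2 => ->; rewrite t2.
  + by apply: contraNneq r2 => E; rewrite -[r]invgK expgVn E t2 invg1.
- rewrite /= !inE negb_or (adj_neq ab) andbT /=; apply/andP; split.
    by apply: contraNneq r1 => E; rewrite -caE -E -[a * a]/(a ^+ 2) a2.
  by apply: contraNneq r1 => E; rewrite -bcE -E -[b * b]/(b ^+ 2) b2.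
- by split.
- by split; apply: adjV.
- by split; apply: adj_S3.
Qed.

Lemma gen_S3 : G \subset <<[set a; b]>>.
Proof.
pose H := <<[set a; b]>>%G; suff : G \subset H by [].
have invH t : t \in G -> t ^+ 2 = 1 -> t \in H.
  move=> tG t2; have [->|t1] := eqVneq t 1; first exact: group1.
  have aH : a \in H by exact: mem_gen2l.
  have bH : b \in H by exact: mem_gen2r.
  by have := involution_S3 tG t2 t1; rewrite !inE => /or3P[] /eqP-> //; rewrite !groupM.
apply/subsetP => g gG; have [->|g1] := eqVneq g 1; first exact: group1.
(* If [g] has order 3, then [h] and [g * h] are involutions with quotient [g]. *)
have [h hG gh] := neq1_adj gG g1; case: (adj_cases gG hG gh) => -[g2 h2 gh2];
  try exact: invH.
by rewrite -(mulgK h g) groupM ?groupV ?invH ?groupM.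
Qed.

End SymmetricEdge.

(** 2-recognizability supplies an edge; if one end has order 3, replacing it by [x * y] gives an
    edge between two involutions. *)
Lemma noK33_S3 : two_recognizable F -> ~ F G -> G \isog [set: {perm 'I_3}].
Proof.
move=> h2 nFG.
have [x [y [xG yG xy]]] : exists x y, [/\ x \in G, y \in G & adj x y].
  apply: contrapT => nex; apply: nFG; apply: h2 => x y xG yG.
  by apply: contrapT => nF; apply: nex; exists x, y.
have [a [b [aG bG ab [a2 b2 ab3]]]] : exists a b, [/\ a \in G, b \in G, adj a b &
    [/\ a ^+ 2 = 1, b ^+ 2 = 1 & (a * b) ^+ 3 = 1]].
  have xyG : x * y \in G by rewrite groupM.
  case: (adj_cases xG yG xy) => -[x2 y2 xy2]; first by exists x, y.
    exists x, (x * y); split=> //; first exact: adjM.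
    by rewrite mulgA -[x * x]/(x ^+ 2) x2 mul1g.
  exists (x * y), y; split=> //; first exact/adjC/adjMr/adjC.
  by rewrite -mulgA -[y * y]/(y ^+ 2) y2 mulg1.
have -> : G :=: <<[set a; b]>>.
  by apply/eqP; rewrite eqEsubset (gen_S3 aG bG) //= gen_subG subUset !sub1set aG.
apply: isog_S3 => //; [exact: adj_neq1 ab | exact: adj_neq1 (adjC ab) | exact: adj_neq].
Qed.

End Adjacency.
End NonFGraph.

Theorem theorem1p6 (F : group_class)
  (hF : formation F) (h2 : two_recognizable F) (hher : hereditary F)
  (hsr : F_semiregular F) (hN : contains_nilpotent F)
  (gT : finGroupType) (G : {group gT}) :
  planar (GammaV F G) (@GammaAdj F gT) <->
  (F gT G \/ G \isog [set: {perm 'I_3}]).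
Proof.
split=> [plG | [FG | isoG]].
- have [FG|nFG] := pselect (F gT G); [by left | right].
  apply: (noK33_S3 hF hher hN _ (hsr _ G) h2 nFG) => x1 x2 x3 y1 y2 y3.
  rewrite -[[:: x1; x2; x3; y1; y2; y3]]/([:: x1; x2; x3] ++ [:: y1; y2; y3]) all_cat.
  move=> /andP[/and4P[x1G x2G x3G _] /and4P[y1G y2G y3G _]] uX uY.
  move=> [a11 a12 a13] [a21 a22 a23] [a31 a32 a33].
  have vtx u w : u \in G -> w \in G -> GammaAdj F u w -> u \in GammaV F G.
    by move=> uG wG uw; rewrite inE uG (adj_IF wG uw).
  have A i j : GammaAdj F (tnth [tuple x1; x2; x3] i) (tnth [tuple y1; y2; y3] j).
    rewrite !(tnth_nth x1).
    by case: i j => [[|[|[|//]]] ?] [[|[|[|//]]] ?].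
  have xG i : tnth [tuple x1; x2; x3] i \in G.
    by rewrite (tnth_nth x1); case: i => [[|[|[|//]]] ?].
  have yG i : tnth [tuple y1; y2; y3] i \in G.
    by rewrite (tnth_nth x1); case: i => [[|[|[|//]]] ?].
  apply: (planar_K33_free plG (x := tnth [tuple x1; x2; x3]) (y := tnth [tuple y1; y2; y3])).
  + exact/tuple_uniqP.
  + exact/tuple_uniqP.
  + by move=> i; exact: vtx (xG i) (yG ord0) (A i ord0).
  + by move=> j; exact: vtx (yG j) (xG ord0) (adjC hher (A ord0 j)).
  + by move=> i j; exact: adj_neq (A i j).
  + exact: A.
- have -> : GammaV F G = set0; last exact: planar_set0.
  apply/setP => x; rewrite !inE; apply/negP => /andP[/nandP[/negP//|/asboolPn nF] xG].
  apply: nF => g gG; apply: hher FG.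
  by rewrite gen_subG subUset !sub1set xG.
have oG : #|G| = 6 by rewrite (card_isog isoG) cardsT card_Sn.
have [r rG or] : {r | r \in G & #[r] = 3} by apply: Cauchy; rewrite ?oG.
(* The three elements outside [<[r]>] come first, so [r] and [r^-1] take the positions 3 and 4 of
   the missing edge; they commute. *)
have sz : size (enum (G :\: <[r]>) ++ [:: r; r^-1]) == 5%N.
  rewrite size_cat -cardE cardsD (setIidPr _) ?cycle_subG //.
  by rewrite -orderE or oG.
apply: (planar_K5_minus_edge (v := Tuple sz)) => [g|i j i2 j2 ij].
- rewrite in_setD => /andP[gI gG].
  (* The identity is isolated, since [<1, h>] is cyclic. *)
  have g1 : g != 1.
    apply: contra gI => /eqP->; rewrite inE group1 /=; apply/asboolP => h hG.
    apply/hN/abelian_nil/cyclic_abelian.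
    apply/cyclicP; exists h; apply/eqP; rewrite eqEsubset cycle_subG mem_gen2r andbT.
    by rewrite gen_subG subUset !sub1set group1 cycle_id.
  rewrite [Tuple sz]/= mem_cat mem_enum in_setD gG andbT.
  have [/cyclePmin[k] | //] := boolP (g \in <[r]>); rewrite or => k3 gE.
  move: k3 g1; rewrite gE; case: k {gE} => [|[|[|//]]] _ //=; first by rewrite eqxx.
    by rewrite !inE expg1 eqxx.
  move=> _; rewrite !inE; apply/orP; right.
  by rewrite eq_sym eq_invg_mul -expgS -order_dvdn or.
have cyc (k : 'I_5) : (2 < k)%N -> tnth (Tuple sz) k \in <[r]>.
  move=> k2; rewrite (tnth_nth 1) /= nth_cat -cardE cardsD (setIidPr _) ?cycle_subG //.
  rewrite -orderE or oG /= ltnNge k2 /=.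
  case: k k2 => [[|[|[|[|[|//]]]]] ?] //= _; rewrite ?groupV cycle_id //.
apply; apply/hN/(nilpotentS _ (abelian_nil (cycle_abelian r))).
by rewrite gen_subG subUset !sub1set !cyc.
Qed.
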